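(* Let $\mu\in\mathbb{R}$, $\sigma>0$, $S_0>0$ be constants, let $\tilde\mu=\mu-\sigma^2/2$, and let $S_t=S_0\exp(\tilde\mu t+\sigma B_t)$ for $t\ge0$. Let $\nu\in\mathbb{R}$, $\psi>0$, $\chi>0$, and let $T$ be a random variable independent of $(B_t)_{t\ge0}$ with the generalized inverse Gaussian distribution $\mathrm{GIG}(\nu,\psi,\chi)$. Then the probability density function of $S_T$ is, for $x>0$, $$f_{\mathrm{GIG}}(x)=\frac{(\psi/\chi)^{\nu/2}}{\sqrt{2\pi}\,\sigma K_\nu(\sqrt{\psi\chi})\,S_0}\left(\frac{x}{S_0}\right)^{\tilde\mu/\sigma^2-1}\left(\frac{(\ln(x/S_0))^2}{\sigma^2}+\chi\right)^{(2\nu-1)/4}\left(\frac{\tilde\mu^2}{\sigma^2}+\psi\right)^{-(2\nu-1)/4}K_{\nu-1/2}\!\left(\sqrt{\left(\frac{(\ln(x/S_0))^2}{\sigma^2}+\chi\right)\left(\frac{\tilde\mu^2}{\sigma^2}+\psi\right)}\right).$$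
   Context: $(B_t)_{t\ge0}$ is a standard one-dimensional Brownian motion with $B_0=0$; $S_t$ is geometric Brownian motion, the It\^o solution of $dS_t=\mu S_t\,dt+\sigma S_t\,dB_t$ started at $S_0$, and $S_T$ is its value at the random time $T$. $K_\nu$ is the modified Bessel function of the second kind. $\mathrm{GIG}(\nu,\psi,\chi)$ is the distribution on $(0,\infty)$ with density $$g_{\mathrm{GIG}}(t;\nu,\psi,\chi)=\frac{(\psi/\chi)^{\nu/2}}{2K_\nu(\sqrt{\psi\chi})}\,t^{\nu-1}\exp\left(-\frac{\psi t}{2}-\frac{\chi}{2t}\right),\qquad t>0.$$ *)

(* Defs.v *)
From mathcomp Require Export all_boot all_order all_algebra.
From mathcomp Require Export all_classical all_reals all_analysis.

Set Implicit Arguments.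
Unset Strict Implicit.
Unset Printing Implicit Defensive.

Import Order.TTheory GRing.Theory Num.Theory.
Import numFieldNormedType.Exports.

Local Open Scope classical_set_scope.
Local Open Scope ring_scope.

Definition cosh {R : realType} (x : R) : R := (expR x + expR (- x)) / 2.

(* K_nu(z) for z > 0 and real nu, by the classical integral
   K_nu(z) = int_0^oo exp(- z cosh t) cosh(nu t) dt (DLMF 10.32.9), which
   converges absolutely; the value at z <= 0 is meaningless. *)
Definition besselK {R : realType} (nu z : R) : R :=
  \int[@lebesgue_measure R]_(t in `[0, +oo[)
    (expR (- (z * cosh t)) * cosh (nu * t)).

(* Meant for t > 0 and psi, chi > 0; restrict with \_ to get a density on R. *)
Definition gig_fun {R : realType} (nu psi chi t : R) : R :=
  (psi / chi) `^ (nu / 2) / (2 * besselK nu (Num.sqrt (psi * chi)))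
  * t `^ (nu - 1) * expR (- (psi * t / 2) - chi / (2 * t)).

(* The law of X is absolutely continuous, with density f with respect to
   Lebesgue measure on R. *)
Definition has_pdf {d : measure_display} {Omega : measurableType d}
    {R : realType} (P : probability Omega R) (X : Omega -> R) (f : R -> R)
    : Prop :=
  [/\ measurable_fun setT X,
      measurable_fun setT f,
      (forall x, 0 <= f x) &
      forall A : set R, measurable A ->
        P (X @^-1` A) = (\int[lebesgue_measure]_(x in A) (f x)%:E)%E].

(* Subfamilies are covered by taking A i = setT for the other indices. *)
Definition mutually_independent {d : measure_display}
    {Omega : measurableType d} {R : realType} (P : probability Omega R)
    (n : nat) (X : 'I_n -> Omega -> R) : Prop :=
  forall A : 'I_n -> set R, (forall i, measurable (A i)) ->
    P (\bigcap_(i in [set: 'I_n]) (X i @^-1` A i)) =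
    (\prod_(i < n) P (X i @^-1` A i))%E.

(* A process indexed by t >= 0 is encoded as a function on R; its values at
   t < 0 are irrelevant and unconstrained. *)
Definition brownian_motion {d : measure_display} {Omega : measurableType d}
    {R : realType} (P : probability Omega R) (B : R -> Omega -> R) : Prop :=
  [/\ (forall t, 0 <= t -> measurable_fun setT (B t)),
      {ae P, forall w, B 0 w = 0},
      (forall (n : nat) (t : nat -> R), 0 <= t 0%N ->
         (forall i, t i < t i.+1) ->
         mutually_independent P
           (fun (i : 'I_n) (w : Omega) => B (t i.+1) w - B (t i) w)),
      (forall s t, 0 <= s -> s < t -> forall A : set R, measurable A ->
         P ((fun w => B t w - B s w) @^-1` A) =
         normal_prob 0 (Num.sqrt (t - s)) A) &
      forall w, {within `[0, +oo[, continuous (fun t => B t w)}].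

Definition process_sigma_algebra {d : measure_display}
    {Omega : measurableType d} {R : realType} (B : R -> Omega -> R)
    : set (set Omega) :=
  <<s [set E | exists t : R, 0 <= t /\
         exists2 A : set R, measurable A & E = B t @^-1` A] >>.

Definition independent_of_process {d : measure_display}
    {Omega : measurableType d} {R : realType} (P : probability Omega R)
    (T : Omega -> R) (B : R -> Omega -> R) : Prop :=
  forall (E : set Omega) (C : set R),
    process_sigma_algebra B E -> measurable C ->
    P (E `&` T @^-1` C) = (P E * P (T @^-1` C))%E.

(* Main.v *)
From HB Require Import structures.
Require Import Defs.
From mathcomp Require Import measurable_realfun ring lra.

Set Implicit Arguments.
Unset Strict Implicit.
Unset Printing Implicit Defensive.

Import Order.TTheory GRing.Theory Num.Theory.
Import numFieldNormedType.Exports.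

Local Open Scope classical_set_scope.
Local Open Scope ring_scope.

(** The idea is to condition on the random time.  Write m for mu - sigma^2 / 2
    and g for the generalized inverse Gaussian density of T.

    Since T is independent of the sigma-algebra generated by B, the pair made of
    T and the path of B has a product law, so an event about B at time T has a
    probability that is the g-mixture over t of the probabilities of the same
    event about B at the fixed time t ([independent_mixture]).  For this to make
    sense, (t, w) |-> B t w has to be jointly measurable for the Borel sets times
    the sigma-algebra of B; continuity of the paths gives it by discretizing
    time ([measurable_process]).

    At a fixed t > 0 the price S0 exp(m t + sigma B_t) is lognormal, because
    B_t is centred normal with variance t ([brownian_marginal],
    [lognormal_law]).  Tonelli's theorem then shows that the price at time T has
    the density x |-> int_0^oo lognormal_pdf t x * g t dt.

    For fixed x > 0, expanding the square in the lognormal exponent shows that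
    the integrand is, up to a factor free of t, again a generalized inverse
    Gaussian kernel t^(l-1) exp(- alpha t / 2 - beta / (2 t)), with
    l = nu - 1/2, alpha = m^2 / sigma^2 + psi and
    beta = ln(x / S0)^2 / sigma^2 + chi ([lognormal_gig_kernel]).  The
    substitution t = sqrt(beta / alpha) e^z turns its exponent into
    - sqrt(alpha beta) cosh z, and folding the line at 0 gives the integral that
    defines K_l ([gig_integral]).  The normalizing constant of g, which involves
    K_nu, is a common factor of both sides.

    Both changes of variables, y |-> c e^(s y) from the line to the half-line,
    are used with integrands that are merely measurable;
    [ge0_integral_expR_subst] provides them by comparing measures instead of
    integrands. *)

(** * Integration against a measure with a density *)

Section density.
Local Open Scope ereal_scope.
Context d (T : measurableType d) (R : realType).
Variables (mu : {measure set T -> \bar R}) (g : T -> R).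
Hypotheses (mg : measurable_fun setT g) (g0 : forall x, (0 <= g x)%R).

(** Measurability and nonnegativity of the density are arguments, so that the
    measure structure below can be attached to the set function. *)
Definition mdensity of measurable_fun setT g & (forall x, (0 <= g x)%R) :=
  fun A : set T => \int[mu]_(x in A) (g x)%:E.

Local Notation rho := (mdensity mg g0).

Let mgE : measurable_fun setT (EFin \o g).
Proof. exact/measurable_EFinP. Qed.

Let mdensity0 : rho set0 = 0.
Proof. exact: integral_set0. Qed.

Let mdensity_ge0 A : 0 <= rho A.
Proof. by apply: integral_ge0 => x _; rewrite lee_fin. Qed.

Let mdensity_sigma_additive : semi_sigma_additive rho.
Proof.
move=> F mF tF mUF; rewrite /mdensity ge0_integral_bigcup//.
- apply: is_cvg_ereal_nneg_natsum_cond => n _ _.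
  by apply: integral_ge0 => x _; rewrite lee_fin.
- exact: measurable_funTS.
- by move=> x _; rewrite lee_fin.
Qed.

HB.instance Definition _ := isMeasure.Build _ _ _ rho
  mdensity0 mdensity_ge0 mdensity_sigma_additive.

Import HBNNSimple.

(** Both sides are limits of the same integrals along nonnegative simple
    functions increasing to [f] (monotone convergence), and for an indicator
    function the formula is the hypothesis on [nu]. *)
Lemma ge0_integral_density (nu : {measure set T -> \bar R}) (f : T -> \bar R) :
    (forall A, measurable A -> nu A = \int[mu]_(x in A) (g x)%:E) ->
    measurable_fun setT f -> (forall x, 0 <= f x) ->
  \int[nu]_x f x = \int[mu]_x (f x * (g x)%:E).
Proof.
move=> nuE mf f0; pose h := nnsfun_approx measurableT mf.
have hf x : (EFin \o h n) x @[n --> \oo] --> f x by exact: cvg_nnsfun_approx.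
have ndh x : {homo (fun n => (h n x)%:E) : a b / (a <= b)%N >-> a <= b}.
  by move=> a b ab; rewrite lee_fin; exact/lefP/nd_nnsfun_approx.
have mh n : measurable_fun setT (EFin \o h n).
  exact/measurable_EFinP/measurable_funP.
have mhg n : measurable_fun setT (fun x => (h n x)%:E * (g x)%:E).
  by apply: emeasurable_funM => //; exact: mh.
have h0 n x : 0 <= (h n x)%:E by rewrite lee_fin.
have g0E x : 0 <= (g x)%:E by rewrite lee_fin.
have lf : \int[nu]_x (EFin \o h n) x @[n --> \oo] --> \int[nu]_x f x.
  rewrite (_ : f = fun x => lim ((EFin \o h n) x @[n --> \oo])); last first.
    by apply/funext => x; apply/esym/cvg_lim => //; exact: hf.
  by apply: cvg_monotone_convergence => //= x _ a b; exact: ndh.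
have lfg : \int[mu]_x ((h n x)%:E * (g x)%:E) @[n --> \oo] -->
    \int[mu]_x (f x * (g x)%:E).
  rewrite (_ : (fun x => f x * _) =
      fun x => lim ((h n x)%:E * (g x)%:E @[n --> \oo])); last first.
    apply/funext => x; apply/esym/cvg_lim => //.
    by apply: cvgeZr => //; exact: hf.
  apply: cvg_monotone_convergence => //=.
  - by move=> n x _; exact: mule_ge0.
  - by move=> x _ a b ab; rewrite lee_wpmul2r//; exact: ndh.
suff hE n : \int[nu]_x (EFin \o h n) x = \int[mu]_x ((h n x)%:E * (g x)%:E).
  by apply: (cvg_unique _ lf) => //; rewrite (funext hE).
have indic0 y x : 0 <= (y * \1_(h n @^-1` [set y]) x)%:E.
  exact: nnfun_muleindic_ge0.
have mindic y : measurable_fun setT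
    (fun x => (y * \1_(h n @^-1` [set y]) x)%:E).
  by apply/measurable_EFinP; apply: measurable_funM.
transitivity (\int[nu]_x
    (\sum_(y \in range (h n)) (y * \1_(h n @^-1` [set y]) x)%:E)).
  by apply: eq_integral => x _; rewrite /= fimfunE -fsumEFin.
rewrite ge0_integral_fsum//.
transitivity (\int[mu]_x (\sum_(y \in range (h n))
    ((y * \1_(h n @^-1` [set y]) x)%:E * (g x)%:E))); last first.
  apply: eq_integral => x _.
  by rewrite -ge0_mule_fsuml// fsumEFin// -(fimfunE _ x).
rewrite ge0_integral_fsum//; last 2 first.
  - by move=> y; exact: emeasurable_funM.
  - by move=> y x _; exact: mule_ge0.
apply: eq_fsbigr => y; rewrite inE => -[t _ <-{y}].
set y := h n t; set D := h n @^-1` [set y].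
have mD : measurable D by exact: measurable_sfunP.
under eq_integral do rewrite EFinM.
have y0 : 0 <= y%:E by exact: h0.
rewrite ge0_integralZl//; last exact/measurable_EFinP.
rewrite integral_indic// setIT nuE//.
under [RHS]eq_integral do rewrite EFinM -muleA.
rewrite ge0_integralZl//; last 2 first.
  by apply: emeasurable_funM => //; exact/measurable_EFinP.
  by move=> x _; rewrite mule_ge0// lee_fin.
congr (_ * _); rewrite integral_mkcond; apply: eq_integral => x _.
by rewrite epatch_indic muleC.
Qed.

End density.

(** * The substitution x = c exp(s z) *)

Section exponential_substitution.
Local Open Scope ereal_scope.
Context (R : realType).
Local Notation leb := (@lebesgue_measure R).
Variables (c s : R) (c0 : (0 < c)%R) (s0 : (0 < s)%R).
Let F z := (c * expR (s * z))%R.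
Let G x := (ln (x / c) / s)%R.
Let D : set R := `]0%R, +oo[%classic.
Let F' z := (c * s * expR (s * z))%R.

Let Fgt0 z : (0 < F z)%R.
Proof. by rewrite mulr_gt0// expR_gt0. Qed.

Let GK x : (0 < x)%R -> F (G x) = x.
Proof.
move=> x0; rewrite /F /G (mulrC s) divfK ?gt_eqF//.
by rewrite lnK ?posrE ?divr_gt0// mulrC divfK ?gt_eqF.
Qed.

Let F_le : {mono F : x y / (x <= y)%R}.
Proof. by move=> x y; rewrite ler_pM2l// ler_expR ler_pM2l. Qed.

Let F_lt : {mono F : x y / (x < y)%R}.
Proof. exact: leW_mono. Qed.


Let G_itv a b : (fun x => G x) @^-1` `]a, b] `&` D = `]F a, F b]%classic.
Proof.
apply/seteqP; split => x; rewrite /D /= !in_itv /= ?andbT.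
  by move=> [abx x0]; rewrite -[x]GK// F_lt F_le.
move=> /andP[ax xb]; have x0 : (0 < x)%R by exact: lt_trans ax.
by rewrite -F_lt -F_le GK// ax xb.
Qed.

Let F'_ge0 z : (0 <= F' z)%R.
Proof. by rewrite !mulr_ge0 ?expR_ge0// ltW. Qed.

Let mG : measurable_fun setT G.
Proof.
apply: measurable_funM => //; apply: measurableT_comp => //.
by apply: measurable_funM.
Qed.

Let mF : measurable_fun setT F.
Proof.
by apply: measurable_funM => //; apply: measurableT_comp.
Qed.

Let mF' : measurable_fun setT F'.
Proof.
by apply: measurable_funM => //; apply: measurableT_comp.
Qed.

Let mD : measurable D. Proof. exact: measurable_itv. Qed.

Let mindic : measurable_fun setT (\1_D : R -> R).
Proof. exact: measurable_indic. Qed.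

Let indic_ge0 x : (0 <= \1_D x :> R)%R.
Proof. by []. Qed.

Let leb_D : {measure set (measurableTypeR R) -> \bar R} :=
  mdensity leb mindic indic_ge0.

Let leb_DE A : measurable A -> leb_D A = leb (A `&` D).
Proof.
move=> mA; transitivity (\int[leb]_(x in A) (\1_D x)%:E) => //.
by rewrite integral_indic// setIC.
Qed.

Let integral_F' a b : (a < b)%R ->
  \int[leb]_(z in `]a, b]) (F' z)%:E = (F b - F a)%:E.
Proof.
move=> ab; rewrite integral_itv_obnd_cbnd//; last first.
  by apply/measurable_EFinP; exact: measurable_funTS.
have dF (z : R) : is_derive z (1%R : R) F (F' z).
  by apply: is_derive_eq; rewrite /F' /GRing.scale /= mulr1 -mulrA;
    rewrite [(expR _ * s)%R]mulrC.
have cF : continuous F.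
  by move=> z; apply/differentiable_continuous/derivable1_diffP; case: (dF z).
have cF' : continuous F'.
  move=> z; rewrite (_ : F' = (fun z => s * F z)%R); last first.
    by apply/funext => y; rewrite /F' /F mulrCA mulrA.
  by apply: cvgM; [exact: cvg_cst|exact: cF].
rewrite (@continuous_FTC2 _ _ F)// ?EFinB//.
- exact: continuous_subspaceT.
- split => [z _||].
  + by case: (dF z).
  + exact/cvg_at_right_filter/cF.
  + exact/cvg_at_left_filter/cF.
- by move=> z _; rewrite derive1E derive_val.
Qed.

(* The image of Lebesgue measure on the half-line under the inverse [G] of [F]. *)
Let law : {measure set (measurableTypeR R) -> \bar R}.
Proof.
unshelve refine
  (pushforward leb_D (G : measurableTypeR R -> measurableTypeR R)).
exact: mG.
Defined.

(* Both measures give mass F b - F a to an interval ]a, b], by the fundamental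
   theorem of calculus on the right. *)
Let lawE A : measurable A ->
  law A = \int[leb]_(z in A) (F' z)%:E.
Proof.
move=> mA.
pose m2 := (mdensity leb mF' F'_ge0 :
  {measure set (measurableTypeR R) -> \bar R}).
change (law A = m2 A).
apply: (@measure_unique _ _ (measurableTypeR R) (@ocitv R)
  (fun n => `](- n%:R)%R, n%:R]%classic)
  _ _ _ _ law m2) => //.
- exact: ocitvI.
- by move=> n; exact: is_ocitv.
- exact: bigcup_itvT.
- move=> X /ocitvP[->|[[a b] /= ab ->]]; first by rewrite !measure0.
  rewrite /law /= /pushforward leb_DE.
    rewrite G_itv lebesgue_measure_itv /= lte_fin F_lt ab -EFinB.
    by rewrite -integral_F'.
  by rewrite -[X in measurable X]setTI; exact: mG.
- move=> n.
  rewrite /law /= /pushforward leb_DE.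
    rewrite G_itv lebesgue_measure_itv /=; case: ifP => _ //; exact: ltry.
  by rewrite -[X in measurable X]setTI; exact: mG.
Qed.

(** The image of Lebesgue measure on the half-line under the inverse of
    z |-> c e^(s z) has density c s e^(s z), since the two measures agree on
    bounded intervals.  Comparing measures reaches every measurable [h] at once, in
    particular the indicators of Borel sets that a law is tested on. *)
Lemma ge0_integral_expR_subst (h : R -> \bar R) : measurable_fun setT h ->
    (forall x, (0 < x)%R -> 0 <= h x) ->
  \int[leb]_(x in `]0%R, +oo[) h x =
  \int[leb]_z (h (c * expR (s * z))%R * (c * s * expR (s * z))%:E).
Proof.
move=> mh h0.
have mhF : measurable_fun setT (h \o F) by exact: measurableT_comp.
have hF0 x : 0 <= (h \o F) x by exact: h0.
rewrite -(@ge0_integral_density _ _ _ leb _ mF' F'_ge0 law (h \o F) lawE)//.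
transitivity (\int[leb_D]_x ((h \o F) \o G) x); last first.
  exact/esym/(@ge0_integral_pushforward _ _ (measurableTypeR R)
    (measurableTypeR R) R G mG leb_D setT).
have mhFG : measurable_fun setT ((h \o F) \o G) by exact: measurableT_comp.
rewrite (@ge0_integral_density _ _ _ leb _ mindic indic_ge0 leb_D
  ((h \o F) \o G))//; last by move=> x; exact: hF0.
rewrite [LHS]integral_mkcond; apply: eq_integral => x _.
rewrite epatch_indic /= indicE; have [xD|] := boolP (x \in D).
  by rewrite GK//; move: xD; rewrite inE /D/= in_itv/= andbT.
by rewrite !mule0.
Qed.

End exponential_substitution.

(** * A process evaluated at an independent time *)

Section independent_time.
Local Open Scope ereal_scope.
Context (R : realType) (d : measure_display) (Omega : measurableType d).
Variables (P : probability Omega R) (B : R -> Omega -> R).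

Let gen : set (set Omega) := [set E | exists t : R, (0 <= t)%R /\
  exists2 A : set R, measurable A & E = B t @^-1` A].

(** [Omega] with the sigma-algebra generated by the process, on which
    independence from [T] is known. *)
Definition path_space : measurableType _ := g_sigma_algebraType gen.

Hypothesis mB : forall t, (0 <= t)%R -> measurable_fun setT (B t).
Hypothesis cB : forall w, {within `[0%R, +oo[, continuous (fun t => B t w)}.

Lemma measurable_to_path_space :
  measurable_fun setT ((fun w => w) : Omega -> path_space).
Proof.
move=> _ A mA; rewrite setTI preimage_id.
apply: mA; split; first exact: sigma_algebra_measurable.
by move=> _ [t [t0 [Y mY ->]]]; rewrite -[X in measurable X]setTI; exact: mB.
Qed.

Lemma path_space_measurable (t : R) : (0 <= t)%R ->
  measurable_fun setT (B t : path_space -> R).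
Proof.
move=> t0 _ A mA; rewrite setTI; apply: sub_sigma_algebra.
by exists t; split => //; exists A.
Qed.

(** Rounding t down to a multiple of 1 / n.+1 makes the process a countable
    patchwork of measurable rectangles, and by continuity of the paths the rounded
    process converges pointwise to the original one. *)
Lemma measurable_process :
  measurable_fun (`[0%R, +oo[ `*` setT : set (measurableTypeR R * path_space))
    (fun tw : measurableTypeR R * path_space => B tw.1 tw.2).
Proof.
pose tn (n : nat) (t : R) : R := ((Num.truncn (t * n.+1%:R)%R)%:R / n.+1%:R)%R.
apply: (@measurable_fun_cvg _ (measurableTypeR R * path_space)%type R _
  (fun n tw => B (tn n tw.1) tw.2)).
- move=> n _ Y mY.
  rewrite (_ : _ `&` _ = \bigcup_k (`[(k%:R / n.+1%:R)%R, (k.+1%:R / n.+1%:R)%R[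
      `*` ((B (k%:R / n.+1%:R)%R : path_space -> R) @^-1` Y))); last first.
    apply/seteqP; split => [[t w] /= [[t0 _] BY]|[t w] /= [k _ [tk BY]]].
      exists (Num.truncn (t * n.+1%:R)%R) => //; split => //=.
      rewrite in_itv /= ler_pdivrMr// ltr_pdivlMr//; apply: truncn_itv.
      by rewrite mulr_ge0//; move: t0; rewrite in_itv /= andbT.
    move: tk; rewrite /= => /andP[]; rewrite !bnd_simp => kt tk.
    have t0 : (0 <= t)%R by rewrite (le_trans _ kt)// divr_ge0.
    split; first by rewrite in_itv /= t0.
    rewrite /tn (@truncn_def _ _ k)//.
    by rewrite -ler_pdivrMr// kt -ltr_pdivlMr.
  apply: bigcup_measurable => k _; apply: measurableX => //.
  by rewrite -[X in measurable X]setTI; exact: path_space_measurable.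
- move=> [t w] /= [t0 _].
  have t_ge0 : (0 <= t)%R by move: t0; rewrite in_itv /= andbT.
  have tn_cvg : tn n t @[n --> \oo] --> t.
    apply/cvgrPdist_le => e e0; near=> n.
    have n0 : (0 < n.+1%:R :> R)%R by [].
    have /andP[] := truncn_itv (mulr_ge0 t_ge0 (ltW n0)).
    rewrite -ler_pdivrMr// -ltr_pdivlMr// => tn_le lt_tn.
    rewrite /tn ger0_norm ?subr_ge0// lerBlDl (le_trans (ltW lt_tn))//.
    rewrite -natr1 mulrDl lerD2l div1r invf_ple ?posrE//.
    rewrite -natr1 ler_wpDr//; near: n; exact: nbhs_infty_ger.
  have cBt := (subspace_continuousP _ (fun t => B t w)).1 (@cB w) t t0.
  apply: (cvg_comp _ _ _ cBt) => U [e /= e0 eU].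
  near=> n; apply: eU; last by rewrite /= in_itv /= andbT divr_ge0.
  by near: n; move/cvgrPdist_lt : tn_cvg; apply.
Unshelve. all: end_near. Qed.

Variable T : Omega -> R.
Hypothesis mT : measurable_fun setT T.
Hypothesis T_B : independent_of_process P T B.
Lemma measurable_time_path : measurable_fun setT
  ((fun w => (T w, w)) : Omega -> measurableTypeR R * path_space).
Proof. exact: (measurable_fun_pair mT measurable_to_path_space). Qed.

Variable g : R -> R.
Hypotheses (mg : measurable_fun setT g) (g0 : forall x, (0 <= g x)%R).
Hypothesis Tg : forall A, measurable A ->
  P (T @^-1` A) = \int[lebesgue_measure]_(x in A) (g x)%:E.

(** By independence the law of (T, w) on R * path_space is the product of the
    law of [T] and of [P], because it is so on rectangles.  The definition of the
    product measure by sections gives an integral over the law of [T], which is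
    rewritten with its density. *)
Lemma independent_mixture (C : set (measurableTypeR R * path_space)) :
  measurable C ->
  P [set w | C (T w, w)] =
  \int[lebesgue_measure]_t (P [set w | C (t, w)] * (g t)%:E).
Proof.
move=> mC.
pose Tf : {mfun Omega >-> measurableTypeR R} :=
  HB.pack (T : Omega -> measurableTypeR R) 
    (isMeasurableFun.Build _ _ Omega (measurableTypeR R) T mT).
pose idf : {mfun Omega >-> path_space} :=
  HB.pack ((fun w => w) : Omega -> path_space) (isMeasurableFun.Build _ _ _ _ _
    measurable_to_path_space).
pose pairf : {mfun Omega >-> (measurableTypeR R * path_space)%type} :=
  HB.pack ((fun w => (T w, w)) : Omega -> measurableTypeR R * path_space)
    (isMeasurableFun.Build _ _ _ _ _ measurable_time_path).
have E : (distribution P Tf \x distribution P idf) C = distribution P pairf C.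
  apply: product_measure_unique => // A1 A2 mA1 mA2.
  rewrite /distribution /pushforward /=.
  rewrite muleC -T_B//; congr (P _).
  by apply/seteqP; split => w; case.
transitivity (distribution P pairf C) => //; rewrite -E.
rewrite /product_measure1.
rewrite (@ge0_integral_density _ _ _ lebesgue_measure g mg g0)//; last first.
  exact: measurable_fun_xsection.
apply: eq_integral => t _; congr (P _ * _).
by apply/seteqP; split => w; rewrite /xsection /= inE.
Qed.

End independent_time.

(** * Generalized inverse Gaussian integrals *)

(** The function x |-> 1 / x equals x * (x^2)^(-1) also at 0, where both vanish,
    and real powers are measurable. *)
Lemma measurable_invr (R : realType) : measurable_fun setT (@GRing.inv R).
Proof.
rewrite (_ : GRing.inv = fun x : R => x * (x ^+ 2) `^ (-1)).
  apply: measurable_funM => //.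
  by apply: (measurableT_comp (measurable_powR (-1))); exact: measurable_funX.
apply/funext => x; rewrite powR_inv1 ?sqr_ge0// -exprVn.
have [->|x0] := eqVneq x 0; first by rewrite invr0 mul0r.
by rewrite expr2 mulrA mulfV// mul1r.
Qed.

Section bessel.
Local Open Scope ereal_scope.
Context (R : realType).
Local Notation leb := (@lebesgue_measure R).

Lemma measurable_cosh : measurable_fun setT (@cosh R).
Proof.
apply: measurable_funM => //; apply: measurable_funD => //.
exact: measurableT_comp.
Qed.

Lemma cosh_ge0 (x : R) : (0 <= cosh x)%R.
Proof. by rewrite /cosh divr_ge0// addr_ge0// expR_ge0. Qed.

Lemma besselK_ge0 (nu z : R) : (0 <= besselK nu z)%R.
Proof.
by apply: Rintegral_ge0 => t _; rewrite mulr_ge0 ?expR_ge0// cosh_ge0.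
Qed.

Lemma cosh_ge_sqr (t : R) : (0 <= t)%R -> (t ^+ 2 / 4 <= cosh t)%R.
Proof.
move=> t0; rewrite /cosh.
have := expR_ge1Dxn 1 t0; have := expR_ge0 (- t).
rewrite (_ : 2`! = 2%N)// => h1 h2.
have -> : (t ^+ 2 / 4 = (t ^+ 2 / 2) / 2)%R by field.
rewrite ler_pM2r ?invr_gt0//.
lra.
Qed.

Lemma cosh_le_expR (x : R) : (cosh x <= expR `|x|)%R.
Proof.
rewrite /cosh ler_pdivrMr// mulr_natr mulr2n lerD// ler_expR ?ler_norm//.
by rewrite -normrN ler_norm.
Qed.

(** As cosh t >= t^2 / 4, the exponent is at most - z t^2 / 4 + |nu| t; completing
    the square bounds - z t^2 / 4 + (|nu| + 1) t by (|nu| + 1)^2 / z. *)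
Lemma besselK_integrand_le (nu z t : R) : (0 < z)%R -> (0 <= t)%R ->
  (expR (- (z * cosh t)) * cosh (nu * t) <=
   expR ((`|nu| + 1) ^+ 2 / z) * expR (- t))%R.
Proof.
move=> z0 t0; set b := (`|nu| + 1)%R.
have ht : (`|nu * t| = (b - 1) * t)%R by rewrite normrM (ger0_norm t0) addrK.
rewrite (le_trans (ler_wpM2l (expR_ge0 _) (cosh_le_expR _)))//.
rewrite -!expRD ler_expR ht.
have zc : (z * (t ^+ 2 / 4) <= z * cosh t)%R by rewrite ler_pM2l// cosh_ge_sqr.
have sq : (0 <= z / 4 * (t - 2 * b / z) ^+ 2)%R.
  by rewrite mulr_ge0 ?sqr_ge0// divr_ge0// ltW.
have E : (z / 4 * (t - 2 * b / z) ^+ 2 = z * (t ^+ 2 / 4) - b * t + b ^+ 2 / z)%R.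
  by field; rewrite gt_eqF.
rewrite E in sq; lra.
Qed.

Lemma measurable_besselK_integrand (nu z : R) (D : set (measurableTypeR R)) :
  measurable_fun D (fun t => (expR (- (z * cosh t)) * cosh (nu * t))%:E).
Proof.
apply/measurable_EFinP/measurable_funTS/measurable_funM.
  apply: measurableT_comp => //; apply: measurableT_comp => //.
  by apply: measurable_funM => //; exact: measurable_cosh.
by apply: (measurableT_comp measurable_cosh); exact: measurable_funM.
Qed.

(** [besselK] is the [fine] part of an extended-real integral; this is where the
    convergence of that integral matters. *)
Lemma besselKE (nu z : R) : (0 < z)%R ->
  (besselK nu z)%:E =
  \int[leb]_(t in `[0%R, +oo[) (expR (- (z * cosh t)) * cosh (nu * t))%:E.
Proof.
move=> z0; rewrite /besselK /Rintegral fineK//.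
set M := expR ((`|nu| + 1) ^+ 2 / z).
have mE : measurable_fun setT (fun t : R => (exponential_pdf 1 t)%:E).
  by apply/measurable_EFinP; exact: measurable_exponential_pdf.
rewrite ge0_fin_numE; last first.
  by apply: integral_ge0 => t _; rewrite lee_fin mulr_ge0 ?expR_ge0// cosh_ge0.
apply: (@le_lt_trans _ _ (\int[leb]_t (M%:E * (exponential_pdf 1 t)%:E))); last first.
  rewrite ge0_integralZl//.
  - by rewrite integral_exponential_pdf// mule1 ltry.
  - by move=> t _; rewrite lee_fin exponential_pdf_ge0.
  - by rewrite lee_fin expR_ge0.
rewrite integral_mkcond; apply: ge0_le_integral => //.
- move=> t _; apply: erestrict_ge0 => s _.
  by rewrite lee_fin mulr_ge0 ?expR_ge0// cosh_ge0.
- by apply/(measurable_restrictT _ (measurable_itv _));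
  exact: measurable_besselK_integrand.
- exact: measurable_funeM.
- move=> t _; rewrite patchE; case: ifPn => t0.
    have t_ge0 : (0 <= t)%R by move: t0; rewrite inE /= in_itv /= andbT.
    rewrite -EFinM lee_fin exponential_pdfE// mul1r mulN1r.
    exact: besselK_integrand_le.
  by rewrite -EFinM lee_fin mulr_ge0 ?expR_ge0// exponential_pdf_ge0.
Qed.

Lemma ge0_integral_fold (phi : R -> R) :
    measurable_fun setT phi -> (forall x, 0 <= phi x)%R ->
  \int[leb]_x (phi x)%:E = \int[leb]_(x in `[0%R, +oo[) (phi x + phi (- x))%:E.
Proof.
move=> mphi phi0.
have mE : measurable_fun setT (fun x => (phi x)%:E) by exact/measurable_EFinP.
have mN : measurable_fun setT (fun x : measurableTypeR R => (phi (- x)%R)%:E).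
  by apply/measurable_EFinP; exact: measurableT_comp.
under [RHS]eq_integral do rewrite EFinD.
rewrite ge0_integralD//; last 4 first.
- by move=> x _; rewrite lee_fin.
- exact: measurable_funTS.
- by move=> x _; rewrite lee_fin.
- exact: measurable_funTS.
rewrite [X in _ + X]ge0_integration_by_substitution0//; last first.
  by move=> x; rewrite lee_fin.
under [X in _ + X]eq_integral do rewrite opprK.
rewrite -integral_itv_bndo_bndc; last exact: measurable_funTS.
rewrite -ge0_integral_setU//=; last 3 first.
- exact: measurable_funTS.
- by move=> x _; rewrite lee_fin.
- apply/disj_setPS => x [] /=; rewrite !in_itv /= andbT => x0.
  by rewrite ltNge x0.
congr (integral _ _ _); apply/esym; rewrite -subTset => x _ /=.
by rewrite !in_itv /= andbT; case: (leP 0%R x); [left|right].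
Qed.

Lemma measurable_gig_kernel (l alpha beta : R) : measurable_fun setT
  (fun t : R =>
    t `^ (l - 1) * expR (- (alpha * t / 2) - beta / (2 * t)))%R.
Proof.
apply: measurable_funM; first exact: measurable_powR.
apply: measurableT_comp => //; apply: measurable_funB.
  by apply: measurableT_comp => //; do 2 apply: measurable_funM => //.
apply: measurable_funM => //; apply: (measurableT_comp (@measurable_invr R)).
exact: measurable_funM.
Qed.

(** The substitution t = c e^z with c = sqrt(beta / alpha) balances the two terms
    of the exponent, as alpha c = beta / c = sqrt(alpha beta): the kernel becomes
    c^l e^(l z) exp(- sqrt(alpha beta) cosh z).  Adding the values at z and - z
    turns e^(l z) into 2 cosh(l z). *)
Lemma gig_integral (l alpha beta : R) : (0 < alpha)%R -> (0 < beta)%R ->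
  \int[leb]_(t in `]0%R, +oo[)
    (t `^ (l - 1) * expR (- (alpha * t / 2) - beta / (2 * t)))%:E =
  (2 * (beta / alpha) `^ (l / 2) * besselK l (Num.sqrt (alpha * beta)))%:E.
Proof.
move=> a0 b0.
set w := Num.sqrt (alpha * beta).
pose c := Num.sqrt (beta / alpha).
have c0 : (0 < c)%R by rewrite sqrtr_gt0 divr_gt0.
have w0 : (0 < w)%R by rewrite sqrtr_gt0 mulr_gt0.
have ac : (alpha * c = w)%R.
  rewrite /w (_ : alpha * beta = alpha ^+ 2 * (beta / alpha))%R.
    by rewrite sqrtrM ?sqr_ge0// sqrtr_sqr gtr0_norm.
  by field; rewrite gt_eqF.
have bc : (beta / c = w)%R.
  have <- : (w * c = beta)%R.
    rewrite -sqrtrM ?mulr_ge0 ?ltW//.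
    rewrite (_ : alpha * beta * _ = beta ^+ 2)%R.
      by rewrite sqrtr_sqr gtr0_norm.
    by field; rewrite gt_eqF.
  by rewrite mulfK ?gt_eqF.
pose h (t : R) := (t `^ (l - 1) * expR (- (alpha * t / 2) - beta / (2 * t)))%R.
have mh : measurable_fun setT h by exact: measurable_gig_kernel.
have h0 t : (0 <= h t)%R by rewrite mulr_ge0 ?expR_ge0// powR_ge0.
rewrite (@ge0_integral_expR_subst _ c 1 c0 ltr01 (fun t => (h t)%:E)); last 2 first.
- exact/measurable_EFinP.
- by move=> t _; rewrite lee_fin.
pose phi z := (expR (- (w * cosh z)) * expR (l * z))%R.
transitivity (\int[leb]_z ((c `^ l)%:E * (phi z)%:E)).
  apply: eq_integral => z _; rewrite -!EFinM; congr EFin.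
  rewrite /h /phi !mulr1 !mul1r.
  have cz0 : (0 < c * expR z)%R by rewrite mulr_gt0// expR_gt0.
  rewrite mulrAC powRB; last by rewrite (gt_eqF cz0) implybT.
  rewrite powRr1 ?ltW// divfK ?gt_eqF// powRM ?expR_ge0 ?ltW// -expRM.
  rewrite -[LHS]mulrA; congr (_ * _)%R; rewrite [RHS]mulrC [(l * z)%R]mulrC.
  congr (_ * expR _)%R.
  rewrite -ac /cosh expRN.
  have -> : (beta = alpha * c ^+ 2)%R.
    by rewrite expr2 mulrA ac -bc divfK ?gt_eqF.
  by field; rewrite !gt_eqF// expR_gt0.
have phi0 z : (0 <= phi z)%R by rewrite mulr_ge0 ?expR_ge0.
have mphi : measurable_fun setT phi.
  apply: measurable_funM; last first.
    by apply: measurableT_comp => //; exact: measurable_funM.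
  apply: measurableT_comp => //; apply: measurableT_comp => //.
  by apply: measurable_funM => //; exact: measurable_cosh.
rewrite ge0_integralZl//; last 3 first.
- exact/measurable_EFinP.
- by move=> z _; rewrite lee_fin.
- by rewrite lee_fin powR_ge0.
rewrite ge0_integral_fold// -mulrA mulrCA !EFinM; congr (_ * _).
  by rewrite /c -powR12_sqrt ?divr_ge0 ?ltW// -powRrM (mulrC _ l).
rewrite besselKE// -ge0_integralZl//; last first.
- by move=> z _; rewrite lee_fin mulr_ge0 ?expR_ge0// cosh_ge0.
- exact: measurable_besselK_integrand.
apply: eq_integral => z _; rewrite -EFinM; congr EFin.
rewrite /phi /cosh opprK mulrN [(expR (- z) + _)%R]addrC -mulrDr.
by field.
Qed.

End bessel.

(** * The price at a fixed time *)

(** The increment from time 0 is normal and differs from the marginal only on the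
    null set where the path does not start at 0. *)
Lemma brownian_marginal (R : realType) (d : measure_display)
    (Omega : measurableType d) (P : probability Omega R) (B : R -> Omega -> R)
    (hB : brownian_motion P B) (t : R) (A : set R) :
  0 < t -> measurable A -> P (B t @^-1` A) = normal_prob 0 (Num.sqrt t) A.
Proof.
move=> t0 mA; have [mB B0 _ incr _] := hB.
rewrite -[t in Num.sqrt t]subr0 -incr//.
have mBt : measurable (B t @^-1` A).
  by rewrite -[X in measurable X]setTI; apply: mB => //; exact: ltW.
have mBt0 : measurable ((fun w => B t w - B 0 w) @^-1` A).
  rewrite -[X in measurable X]setTI; apply: measurable_funB => //; apply: mB => //.
  exact: ltW.
rewrite -[X in P X]setIT -[in RHS](setIT (_ @^-1` _)).
rewrite -!integral_indic//; apply: ae_eq_integral => //.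
- by apply/measurable_EFinP; exact: measurable_indic.
- by apply/measurable_EFinP; exact: measurable_indic.
apply: filterS B0 => w B0w _ /=.
rewrite !indicE; congr ((nat_of_bool _)%:R%:E).
by apply/idP/idP; rewrite !inE /= B0w subr0.
Qed.

Section lognormal.
Local Open Scope ereal_scope.
Context (R : realType).
Local Notation leb := (@lebesgue_measure R).

Definition lognormal_pdf (S0 m sigma t x : R) : R :=
  (expR (- (ln (x / S0) - m * t) ^+ 2 / (2 * sigma ^+ 2 * t))
   / (Num.sqrt (2 * pi * t) * sigma * x))%R.

Variables (S0 m sigma : R) (S0_gt0 : (0 < S0)%R) (sigma_gt0 : (0 < sigma)%R).

Lemma lognormal_pdf_ge0 (t x : R) : (0 < x)%R ->
  (0 <= lognormal_pdf S0 m sigma t x)%R.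
Proof.
by move=> x0; rewrite divr_ge0 ?expR_ge0// !mulr_ge0 ?sqrtr_ge0// ltW.
Qed.

Lemma measurable_lognormal_pdf :
  measurable_fun setT (fun tx : measurableTypeR R * measurableTypeR R =>
    lognormal_pdf S0 m sigma tx.1 tx.2).
Proof.
have m1 : measurable_fun setT (fun tx : measurableTypeR R * measurableTypeR R =>
  (tx.1 : R)) by exact: measurable_fst.
have m2 : measurable_fun setT (fun tx : measurableTypeR R * measurableTypeR R =>
  (tx.2 : R)) by exact: measurable_snd.
have minv := @measurable_invr R.
have msqrt : measurable_fun setT (@Num.sqrt R).
  by apply: continuous_measurable_fun; exact: sqrt_continuous.
apply: measurable_funM.
  apply: (measurableT_comp (@measurable_expR R)); apply: measurable_funM.
    apply: measurableT_comp => //; apply: measurable_funX.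
    apply: measurable_funB; last exact: measurable_funM.
    by apply: (measurableT_comp (@measurable_ln R)); exact: measurable_funM.
  by apply: (measurableT_comp minv); exact: measurable_funM.
apply: (measurableT_comp minv); apply: measurable_funM => //.
apply: measurable_funM => //; apply: (measurableT_comp msqrt).
exact: measurable_funM.
Qed.

(** The normal integral over y becomes an integral over the price
    x = S0 e^(m t) e^(sigma y). *)
Lemma lognormal_law (t : R) (A : set R) : (0 < t)%R -> measurable A ->
  normal_prob 0 (Num.sqrt t) [set y | A (S0 * expR (m * t + sigma * y))%R] =
  \int[leb]_(x in `]0%R, +oo[) (\1_A x * lognormal_pdf S0 m sigma t x)%:E.
Proof.
move=> t0 mA.
pose c := (S0 * expR (m * t))%R.
have c0 : (0 < c)%R by rewrite mulr_gt0 ?expR_gt0.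
have cE y : (S0 * expR (m * t + sigma * y) = c * expR (sigma * y))%R.
  by rewrite expRD mulrA.
rewrite (@ge0_integral_expR_subst _ _ _ c0 sigma_gt0
  (fun x => (\1_A x * lognormal_pdf S0 m sigma t x)%:E)); last 2 first.
- apply/measurable_EFinP; apply: measurable_funM; first exact: measurable_indic.
  exact: (measurableT_comp measurable_lognormal_pdf
    (pair1_measurable (t : measurableTypeR R))).
- by move=> x x0; rewrite lee_fin mulr_ge0// lognormal_pdf_ge0.
rewrite /normal_prob integral_mkcond; apply: eq_integral => y _.
rewrite epatch_indic /= -!EFinM; congr EFin.
rewrite [LHS]mulrC -[RHS]mulrA; congr (_ * _)%R.
  by rewrite !indicE; congr ((nat_of_bool _)%:R); apply/idP/idP; rewrite !inE /= cE.
have st0 : (0 < Num.sqrt t)%R by rewrite sqrtr_gt0.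
rewrite normal_pdfE ?gt_eqF// /normal_peak /normal_fun /lognormal_pdf.
rewrite sqr_sqrtr ?ltW// subr0.
have -> : (ln (c * expR (sigma * y) / S0) = m * t + sigma * y)%R.
  by rewrite -cE mulrAC divff ?gt_eqF// mul1r expRK.
rewrite [(m * t + _)%R]addrC addrK.
have -> : (- (sigma * y) ^+ 2 / (2 * sigma ^+ 2 * t) = - y ^+ 2 / (t *+ 2))%R.
  by field; rewrite !gt_eqF.
have -> : (t * pi *+ 2 = 2 * pi * t)%R by ring.
have p0 : (0 < Num.sqrt (2 * pi * t))%R by rewrite sqrtr_gt0 !mulr_gt0// pi_gt0.
by field; rewrite !gt_eqF// expR_gt0.
Qed.

End lognormal.

(** * Mixing lognormal densities over the time *)

Section lognormal_gig.
Context (R : realType).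
Local Notation leb := (@lebesgue_measure R).
Variables (S0 m sigma nu psi chi : R).
Hypotheses (S0_gt0 : 0 < S0) (sigma_gt0 : 0 < sigma).
Hypotheses (psi_gt0 : 0 < psi) (chi_gt0 : 0 < chi).

(** In (ln(x / S0) - m t)^2 / (2 sigma^2 t) the cross term is free of t, while the
    two squares add to the coefficients of 1 / t and t; the factor t^(-1/2) shifts
    the index from nu to nu - 1/2. *)
Lemma lognormal_gig_kernel (t x : R) : 0 < t -> 0 < x ->
  lognormal_pdf S0 m sigma t x * gig_fun nu psi chi t =
  (psi / chi) `^ (nu / 2) / (2 * besselK nu (Num.sqrt (psi * chi)))
  / (Num.sqrt (2 * pi) * sigma * x) * expR (m * ln (x / S0) / sigma ^+ 2)
  * (t `^ ((nu - 1 / 2) - 1) *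
     expR (- ((m ^+ 2 / sigma ^+ 2 + psi) * t / 2)
           - (ln (x / S0) ^+ 2 / sigma ^+ 2 + chi) / (2 * t))).
Proof.
move=> t0 x0; rewrite /lognormal_pdf /gig_fun.
set L := ln (x / S0); set K := besselK _ _.
have -> : Num.sqrt (2 * pi * t) = Num.sqrt (2 * pi) * Num.sqrt t.
  by rewrite sqrtrM// mulr_ge0// pi_ge0.
have -> : t `^ (nu - 1 / 2 - 1) = t `^ (nu - 1) / Num.sqrt t.
  rewrite (_ : nu - 1 / 2 - 1 = (nu - 1) - 2^-1); last by field.
  by rewrite powRB ?powR12_sqrt ?ltW// (gt_eqF t0) implybT.
have E : expR (- (L - m * t) ^+ 2 / (2 * sigma ^+ 2 * t)) *
    expR (- (psi * t / 2) - chi / (2 * t)) =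
    expR (m * L / sigma ^+ 2) * expR (- ((m ^+ 2 / sigma ^+ 2 + psi) * t / 2)
           - (L ^+ 2 / sigma ^+ 2 + chi) / (2 * t)).
  by rewrite -!expRD; congr expR; field; rewrite !gt_eqF.
rewrite [(Num.sqrt (2 * pi) * Num.sqrt t * sigma * x)^-1](_ : _ =
  (Num.sqrt (2 * pi) * sigma * x)^-1 / Num.sqrt t); last first.
  by rewrite -!invfM; congr (_^-1); ring.
set a := expR _ in E *; set b := expR _ in E *.
rewrite [LHS](_ : _ = (psi / chi) `^ (nu / 2) / (2 * K)
   / (Num.sqrt (2 * pi) * sigma * x) * (t `^ (nu - 1) / Num.sqrt t) * (a * b)).
  by rewrite E; ring.
by ring.
Qed.

Lemma lognormal_gig_integral (x : R) : 0 < x ->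
  (\int[leb]_(t in `]0%R, +oo[)
    (lognormal_pdf S0 m sigma t x * gig_fun nu psi chi t)%:E =
  ((psi / chi) `^ (nu / 2)
    / (Num.sqrt (2 * pi) * sigma * besselK nu (Num.sqrt (psi * chi)) * S0)
    * (x / S0) `^ (m / sigma ^+ 2 - 1)
    * (ln (x / S0) ^+ 2 / sigma ^+ 2 + chi) `^ ((2 * nu - 1) / 4)
    * (m ^+ 2 / sigma ^+ 2 + psi) `^ (- ((2 * nu - 1) / 4))
    * besselK (nu - 1 / 2)
        (Num.sqrt ((ln (x / S0) ^+ 2 / sigma ^+ 2 + chi)
                   * (m ^+ 2 / sigma ^+ 2 + psi))))%:E)%E.
Proof.
move=> x0; set L := ln (x / S0).
set alpha := m ^+ 2 / sigma ^+ 2 + psi.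
set beta := L ^+ 2 / sigma ^+ 2 + chi.
have a0 : 0 < alpha by rewrite ltr_wpDl// divr_ge0// sqr_ge0.
have b0 : 0 < beta by rewrite ltr_wpDl// divr_ge0// sqr_ge0.
set K := besselK nu _; set K' := besselK _ (Num.sqrt (beta * alpha)).
pose C := (psi / chi) `^ (nu / 2) / (2 * K) / (Num.sqrt (2 * pi) * sigma * x)
  * expR (m * L / sigma ^+ 2).
have C0 : 0 <= C.
  rewrite !mulr_ge0 ?invr_ge0 ?powR_ge0 ?expR_ge0//.
    by rewrite mulr_ge0// besselK_ge0.
  by rewrite !mulr_ge0 ?sqrtr_ge0// ltW.
transitivity (\int[leb]_(t in `]0%R, +oo[) (C%:E *
  (t `^ ((nu - 1 / 2) - 1) * expR (- (alpha * t / 2) - beta / (2 * t)))%:E))%E.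
  apply: eq_integral => t; rewrite inE /= in_itv /= andbT => t0.
  by rewrite -EFinM lognormal_gig_kernel.
rewrite ge0_integralZl//; last 2 first.
- apply/measurable_EFinP/measurable_funTS; exact: measurable_gig_kernel.
- by move=> t _; rewrite lee_fin mulr_ge0 ?powR_ge0 ?expR_ge0.
rewrite gig_integral// -EFinM; congr EFin.
rewrite [alpha * beta]mulrC -/K'.
have xS0 : 0 < x / S0 by rewrite divr_gt0.
have -> : (x / S0) `^ (m / sigma ^+ 2 - 1) = expR (m * L / sigma ^+ 2) / (x / S0).
  rewrite powRB ?powRr1 ?(ltW xS0)//; last by rewrite (gt_eqF xS0) implybT.
  by congr (_ / _); rewrite /powR (gt_eqF xS0) -/L mulrAC.
have -> : (beta / alpha) `^ ((nu - 1 / 2) / 2) =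
    beta `^ ((2 * nu - 1) / 4) * alpha `^ (- ((2 * nu - 1) / 4)).
  rewrite (_ : (nu - 1 / 2) / 2 = (2 * nu - 1) / 4); last by field.
  set e := (2 * nu - 1) / 4.
  rewrite powRN -[X in X `^ e / _](@divfK _ alpha) ?gt_eqF//.
  by rewrite [in RHS]powRM ?ltW ?divr_gt0// mulfK// gt_eqF ?powR_gt0.
rewrite /C.
(* Both sides carry a factor 1 / K, whose value at K = 0 is 0. *)
have [->|K0] := eqVneq K 0.
  by rewrite !(mulr0, mul0r, invr0).
have p0 : 0 < Num.sqrt (2 * pi) :> R by rewrite sqrtr_gt0 mulr_gt0// pi_gt0.
by field; rewrite K0 (gt_eqF p0) !gt_eqF.
Qed.

End lognormal_gig.

(** * The density of the stopped price *)

Theorem mainTheorem2 (R : realType) (d : measure_display)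
    (Omega : measurableType d) (P : probability Omega R)
    (B : R -> Omega -> R) (hB : brownian_motion P B)
    (mu sigma S0 : R) (hsigma : 0 < sigma) (hS0 : 0 < S0)
    (nu psi chi : R) (hpsi : 0 < psi) (hchi : 0 < chi)
    (T : Omega -> R) (hT0 : forall w, 0 <= T w)
    (hTB : independent_of_process P T B)
    (hT : has_pdf P T (gig_fun nu psi chi \_ `]0, +oo[)) :
  let mut := mu - sigma ^+ 2 / 2 in
  let S := fun (t : R) (w : Omega) => S0 * expR (mut * t + sigma * B t w) in
  let f := fun x : R =>
    (psi / chi) `^ (nu / 2)
    / (Num.sqrt (2 * pi) * sigma * besselK nu (Num.sqrt (psi * chi)) * S0)
    * (x / S0) `^ (mut / sigma ^+ 2 - 1)
    * (ln (x / S0) ^+ 2 / sigma ^+ 2 + chi) `^ ((2 * nu - 1) / 4)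
    * (mut ^+ 2 / sigma ^+ 2 + psi) `^ (- ((2 * nu - 1) / 4))
    * besselK (nu - 1 / 2)
        (Num.sqrt ((ln (x / S0) ^+ 2 / sigma ^+ 2 + chi)
                   * (mut ^+ 2 / sigma ^+ 2 + psi))) in
  has_pdf P (fun w => S (T w) w) (f \_ `]0, +oo[).
Proof.
move=> mut S f.
have [mB _ _ _ cB] := hB.
have [mT mg g_ge0 Tg] := hT.
set g := gig_fun nu psi chi \_ `]0, +oo[ in mg g_ge0 Tg.
pose Y (tw : measurableTypeR R * path_space B) := S tw.1 tw.2.
pose D : set (measurableTypeR R * path_space B) := `[0%R, +oo[ `*` setT.
have mD : measurable D by exact: measurableX.
have mY : measurable_fun D Y.
  apply: measurable_funM => //; apply: measurableT_comp => //.
  apply: measurable_funD.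
    apply: measurable_funM => //; exact: measurable_funTS.
  by apply: measurable_funM => //; exact: measurable_process.
have mTw := measurable_time_path mB mT.
have DT w : D (T w, w) by split => //=; rewrite in_itv /= hT0.
have mST : measurable_fun setT (fun w => S (T w) w).
  move=> _ A mA; rewrite setTI.
  rewrite (_ : _ @^-1` _ = [set w | (D `&` Y @^-1` A) (T w, w)]).
    by rewrite -[X in measurable X]setTI; apply: mTw => //; exact: mY.
  by apply/seteqP; split => w //= [].
(* The joint density of price and time; the indicator makes it nonnegative on
   the whole plane, as Tonelli's theorem requires. *)
pose ind : R -> R := \1_(`]0, +oo[%classic : set R).
pose k (x t : R) := ind x * (lognormal_pdf S0 mut sigma t x * g t).
have k_ge0 x t : 0 <= k x t.
  rewrite /k /ind indicE; have [|] := boolP (x \in _); last by rewrite mul0r.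
  rewrite inE /= in_itv /= andbT => x0.
  by rewrite mul1r mulr_ge0// lognormal_pdf_ge0.
have mk : measurable_fun setT
    (fun xt : measurableTypeR R * measurableTypeR R => k xt.1 xt.2).
  apply: measurable_funM.
    apply: (measurableT_comp _ (@measurable_fst _ _ _ _)).
    exact: measurable_indic.
  apply: measurable_funM; last first.
    by apply: (measurableT_comp mg); exact: measurable_snd.
  apply: (measurableT_comp (@measurable_lognormal_pdf R S0 mut sigma)
    (measurable_fun_pair _ _)); [exact: measurable_snd|exact: measurable_fst].
have mkx x : measurable_fun setT (fun t : measurableTypeR R => (k x t)%:E).
  apply/measurable_EFinP.
  exact: (measurableT_comp mk (pair1_measurable (x : measurableTypeR R))).
have kE x : (\int[lebesgue_measure]_t (k x t)%:E = ((f \_ `]0, +oo[) x)%:E)%E.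
  rewrite /k /ind indicE patchE; have [x0|x0] := boolP (x \in _); last first.
    by apply: integral0_eq => t _; rewrite mul0r.
  rewrite -lognormal_gig_integral//; last first.
    by move: x0; rewrite inE /= in_itv /= andbT.
  rewrite [RHS]integral_mkcond; apply: eq_integral => t _.
  by rewrite mul1r /g !patchE; case: ifP => //; rewrite mulr0.
have mf : measurable_fun setT (f \_ `]0, +oo[).
  apply/measurable_EFinP; rewrite (_ : EFin \o _ = fubini_F lebesgue_measure
     (fun xt : measurableTypeR R * measurableTypeR R => (k xt.1 xt.2)%:E)).
    apply: measurable_fun_fubini_tonelli_F.
      exact/measurable_EFinP.
    by move=> xt; rewrite lee_fin.
  by apply/funext => x; rewrite /fubini_F kE.
split => //.
  by move=> x; rewrite -lee_fin -kE integral_ge0// => t _; rewrite lee_fin.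
move=> A mA.
rewrite (_ : _ @^-1` _ = [set w | (D `&` Y @^-1` A) (T w, w)]); last first.
  by apply/seteqP; split => w //= [].
rewrite (independent_mixture mB mT hTB mg g_ge0 Tg); last exact: mY.
transitivity (\int[lebesgue_measure]_t \int[lebesgue_measure]_x
    (\1_A x * k x t)%:E)%E.
  apply: eq_integral => t _.
  (* The fixed-time law is available for t > 0 only; elsewhere g vanishes. *)
  have [t0|t0] := ltP 0 t; last first.
    have g0 : g t = 0.
      by rewrite /g patchE ifN// notin_setE /= in_itv /= andbT ltNge t0.
    rewrite g0 mule0 integral0_eq// => x _.
    by rewrite /k g0 !mulr0.
  rewrite (_ : [set w | _] =
      B t @^-1` [set y | A (S0 * expR (mut * t + sigma * y))]); last first.
    apply/seteqP; split => w /=; first by case.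
    by split => //; split => //=; rewrite in_itv /= (ltW t0).
  rewrite (brownian_marginal hB)//; last first.
    rewrite -[X in measurable X]setTI.
    rewrite -/((fun y => S0 * expR (mut * t + sigma * y)) @^-1` A).
    have : measurable_fun setT (fun y : R => S0 * expR (mut * t + sigma * y)).
      apply: measurable_funM => //; apply: measurableT_comp => //.
      by apply: measurable_funD => //; exact: measurable_funM.
    by apply.
  rewrite lognormal_law// muleC -ge0_integralZl//; last 3 first.
  - apply/measurable_EFinP; apply: measurable_funM.
      by apply: measurable_funTS; exact: measurable_indic.
    apply: measurable_funTS.
    exact: (measurableT_comp (@measurable_lognormal_pdf R S0 mut sigma)
      (pair1_measurable (t : measurableTypeR R))).
  - move=> x; rewrite /= in_itv /= andbT => x0.
    by rewrite lee_fin mulr_ge0// lognormal_pdf_ge0.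
  - by rewrite lee_fin.
  rewrite integral_mkcond; apply: eq_integral => x _.
  by rewrite epatch_indic /= -!EFinM; congr EFin; rewrite /k /ind; ring.
rewrite (@fubini_tonelli _ _ (measurableTypeR R) (measurableTypeR R) R
   lebesgue_measure lebesgue_measure (fun tx => (\1_A tx.2 * k tx.2 tx.1)%:E)); last 2 first.
- apply/measurable_EFinP; apply: measurable_funM.
    apply: (measurableT_comp _ (@measurable_snd _ _ _ _)).
    exact: measurable_indic.
  apply: (measurableT_comp mk (measurable_fun_pair _ _)).
  + exact: measurable_snd.
  + exact: measurable_fst.
- by move=> tx; rewrite lee_fin mulr_ge0.
rewrite [RHS]integral_mkcond; apply: eq_integral => x _.
rewrite /fubini_G /= epatch_indic /= -kE muleC -ge0_integralZl//.
by move=> t _; rewrite lee_fin.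
Qed.
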